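(* Assume ZFC together with $2^{\mathfrak c}=\mathfrak c^+$, where $\mathfrak c=\operatorname{card}(\mathbb R)$. If there exists a field $\widehat{\mathbb R}$ satisfying Axioms 1--5 (listed in the context), then $\widehat{\mathbb R}$ is unique up to field isomorphism; that is, any two fields satisfying Axioms 1--5 are isomorphic as fields. Consequently, the field $\widehat{\mathbb C}:=\widehat{\mathbb R}(i)$ is also uniquely determined by Axioms 1--5 up to field isomorphism.
   Context: For a cardinal $\kappa$, $\kappa^+$ denotes its successor. For a totally ordered field $\mathbb K$, $\mathbb K_+$ is the set of its positive elements, $x\in\mathbb K$ is infinitesimal if $|x|<1/n$ for all $n\in\mathbb N=\{1,2,\dots\}$, finite if $|x|\le n$ for some $n\in\mathbb N$, and $\mathcal F(\mathbb K)$ is the set of finite elements. A field $\mathbb K$ is real closed if for every $a\in\mathbb K$ at least one of $x^2=a$, $x^2=-a$ has a solution in $\mathbb K$, every polynomial of odd degree over $\mathbb K$ has a root in $\mathbb K$, and $\mathbb K$ is orderable; a real closed field is always given its unique field order ($x\ge 0$ iff $x$ is a square). A totally ordered field $\mathbb K$ with $\operatorname{card}(\mathbb K)=\kappa^+$, $\kappa$ an infinite cardinal, is Cantor complete if every family $\{[a_\gamma,b_\gamma]\}_{\gamma\in\Gamma}$ of bounded closed intervals in $\mathbb K$ with the finite intersection property and $\operatorname{card}(\Gamma)\le\kappa$ has non-empty intersection. An infinitesimal scale of $\mathbb K$ is a positive infinitesimal $s\in\mathbb K$ such that the sequence $(s^{-n})_{n\in\mathbb N}$ is unbounded from above in $\mathbb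 K$. Axioms for $\widehat{\mathbb R}$: Axiom 1: $\operatorname{card}(\widehat{\mathbb R})=\mathfrak c^+$. Axiom 2: $\widehat{\mathbb R}$ is a real closed Cantor complete field. Axiom 3: $\widehat{\mathbb R}$ contains $\mathbb R$ as a subfield. Axiom 4: $\widehat{\mathbb R}$ admits an infinitesimal scale. Axiom 5: for every infinitesimal scale $s\in\widehat{\mathbb R}$ there is a strictly decreasing function $\exp_s:\mathcal F(\widehat{\mathbb R})\to\widehat{\mathbb R}_+$ which is a group isomorphism from $(\mathcal F(\widehat{\mathbb R}),+)$ onto $(\widehat{\mathbb R}_+,\cdot)$ such that $\exp_s(q)=s^q$ for all $q\in\mathbb Q$. *)

(* Defs.v *)
From mathcomp Require Import all_boot all_order all_algebra.
From mathcomp Require Import boolp classical_sets functions cardinality.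
From mathcomp Require Import set_interval reals.
From mathcomp Require Import complex.

Set Implicit Arguments.
Unset Strict Implicit.
Unset Printing Implicit Defensive.

Import Order.TTheory GRing.Theory Num.Theory.

Local Open Scope classical_set_scope.
Local Open Scope card_scope.
Local Open Scope ring_scope.

(* card T = (card U)^+ : card T is the least cardinal above card U. *)
Definition card_succ (T U : Type) : Prop :=
  [/\ [set: U] #<= [set: T],
      ~ ([set: T] #<= [set: U]) &
      forall V : Type, ~ ([set: V] #<= [set: U]) -> [set: T] #<= [set: V]].

Section Fields.
Variable K : rcfType.

Definition infinitesimal (x : K) : Prop :=
  forall n : nat, (0 < n)%N -> `|x| < n%:R^-1.

Definition finite_elts : set K :=
  [set x | exists2 n : nat, (0 < n)%N & `|x| <= n%:R].

Definition positive_elts : set K := [set x | 0 < x].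

(* Cantor completeness of a field of cardinality (card U)^+. The cardinality
   of K is not part of this predicate: it is stated in [hatR_card] below. *)
Definition Cantor_complete (U : Type) : Prop :=
  forall (G : Type) (a b : G -> K),
    [set: G] #<= [set: U] ->
    (forall D : set G, finite_set D ->
       \bigcap_(g in D) `[a g, b g]%classic !=set0) ->
    \bigcap_(g in [set: G]) `[a g, b g]%classic !=set0.

Definition infinitesimal_scale (s : K) : Prop :=
  [/\ 0 < s, infinitesimal s &
      ~ has_ubound [set s ^- n | n in [set n : nat | (0 < n)%N]]].

Definition nth_root (n : nat) (x : K) : K :=
  xget 0 [set y | 0 <= y /\ y ^+ n = x].

Lemma nth_rootP (n : nat) (x : K) : (0 < n)%N -> 0 <= x ->
  0 <= nth_root n x /\ nth_root n x ^+ n = x.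
Proof.
move=> n_gt0 x_ge0.
suff [y Py] : exists y : K, 0 <= y /\ y ^+ n = x.
  by rewrite /nth_root; case: xgetP => [_ _ //|/(_ y) []].
pose p : {poly K} := 'X^n - x%:P.
have px y : p.[y] = y ^+ n - x by rewrite !hornerE.
have x1_ge0 : 0 <= x + 1 by rewrite addr_ge0.
have [|y /andP[y_ge0 _] /rootP] := @poly_ivt K p 0 (x + 1) x1_ge0.
  rewrite !px expr0n gtn_eqF // sub0r oppr_le0 x_ge0 subr_ge0 /=.
  apply: (@le_trans _ _ (x + 1)); first by rewrite lerDl.
  by rewrite -[leLHS]expr1 ler_weXn2l // lerDr.
by rewrite px => /subr0_eq yn; exists y.
Qed.

Lemma nth_root_unique (n : nat) (x y : K) : (0 < n)%N ->
  0 <= y -> y ^+ n = x -> nth_root n x = y.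
Proof.
move=> n_gt0 y_ge0 yx.
have x_ge0 : 0 <= x by rewrite -yx exprn_ge0.
have [r_ge0 rx] := nth_rootP n_gt0 x_ge0.
by apply: (pexpIrn n_gt0); rewrite ?nnegrE // rx yx.
Qed.

(* s^(m/d) = (s^(1/d))^m, with m/d in lowest terms and d > 0. *)
Definition ratpow (s : K) (q : rat) : K :=
  nth_root `|denq q|%N s ^ numq q.

(* [e] is only meaningful on the finite elements of K. *)
Definition is_exp (s : K) (e : K -> K) : Prop :=
  [/\ {in finite_elts &, forall x y, x < y -> e y < e x},
      set_bij finite_elts positive_elts e,
      {in finite_elts &, forall x y, e (x + y) = e x * e y} &
      forall q : rat, e (ratr q) = ratpow s q].

End Fields.

(* Real-closedness is carried by [rcfType]. *)
Record hatR_axioms (R : realType) (K : rcfType) : Prop := {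
  hatR_card : card_succ K R;
  hatR_complete : Cantor_complete K R;
  hatR_real : inhabited {rmorphism R -> K};
  hatR_scale : exists s : K, infinitesimal_scale s;
  hatR_exp : forall s : K, infinitesimal_scale s ->
    exists e : K -> K, is_exp s e
}.

Definition field_isomorphic (F1 F2 : fieldType) : Prop :=
  exists f : {rmorphism F1 -> F2}, bijective f.

(* Main.v *)
From HB Require Import structures.
From Stdlib Require Import Inverse_Image.
Require Import Defs.
From mathcomp Require Import all_boot all_order all_algebra.
From mathcomp Require Import boolp classical_sets functions cardinality.
From mathcomp Require Import set_interval reals.
From mathcomp Require Import complex.
From mathcomp Require Import wochoice polyrcf qe_rcf_th ring lra zify.

(** Write c for the cardinality of the reals. The isomorphism is built by a
back-and-forth of length c^+ between K1 and K2, whose stages are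
sign-preserving subrings G of K1 * K2 of cardinality at most c, starting from
Z[(s, t)] for infinitesimal scales s and t. Given G and x, pass to a maximal
sign-preserving subring N containing G; Sturm's theorem (in the form of
Tarski queries, computed by the same pseudo-remainder sequence on both sides)
makes both projections of N relatively algebraically closed. If x is not yet
in the domain of N, the pairs of N that are algebraic over G define at most c
intervals of K2, and Cantor completeness yields a point y in all of them.
Since the powers of the scale are coinitial in the positive elements, no
algebraic element can be adjacent to the cut, so y lies strictly inside and
has the same type over G as x. *)

Set Implicit Arguments.
Unset Strict Implicit.
Unset Printing Implicit Defensive.

Import Order.TTheory GRing.Theory Num.Theory Pdiv.CommonRing.

Local Open Scope classical_set_scope.
Local Open Scope card_scope.
Local Open Scope ring_scope.

(** * Sign-preserving subrings of a product of real closed fields *)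

Lemma eq_variation (K L : rcfType) (a b : K) (c d : L) :
  sgz a = sgz c -> sgz b = sgz d -> variation a b = variation c d.
Proof.
by move=> ac bd; rewrite /variation -(sgz_lt0 (a * b)) -(sgz_lt0 (c * d))
  !sgzM ac bd.
Qed.

Section PartialIso.
Variables K L : rcfType.
Implicit Types (G : set (K * L)) (u v : K * L).

(** A difference of related elements vanishes on one side exactly when it vanishes on the other, so
    [G] is the graph of an order isomorphism between subrings of [K] and [L]. *)
Definition partial_iso G : Prop :=
  [/\ G 1, forall u v, G u -> G v -> G (u - v),
      forall u v, G u -> G v -> G (u * v) &
      forall u, G u -> sgz u.1 = sgz u.2].

Definition poly_rel G (p : {poly K}) (q : {poly L}) : Prop :=
  forall i, G (p`_i, q`_i).

Definition adjoin G u : set (K * L) :=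
  [set v | exists p q, poly_rel G p q /\ v = (p.[u.1], q.[u.2])].

Lemma poly_relS G H p q : G `<=` H -> poly_rel G p q -> poly_rel H p q.
Proof. by move=> GH pq i; exact: GH. Qed.

Section Rel.
Variable G : set (K * L).
Hypothesis isoG : partial_iso G.

Let G1 : G 1. Proof. by case: isoG. Qed.
Let GB u v : G u -> G v -> G (u - v).
Proof. by case: isoG => _ + _ _; apply. Qed.
Let GM u v : G u -> G v -> G (u * v).
Proof. by case: isoG => _ _ + _; apply. Qed.
Let Gsgz a b : G (a, b) -> sgz a = sgz b.
Proof. by case: isoG => _ _ _ Gs /Gs. Qed.

Lemma piso0 : G 0. Proof. by rewrite -(subrr 1); exact: GB. Qed.

Lemma pisoN u : G u -> G (- u).
Proof. by move=> Gu; rewrite -sub0r; apply: GB => //; exact: piso0. Qed.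

Lemma pisoD u v : G u -> G v -> G (u + v).
Proof. by move=> Gu Gv; rewrite -[v]opprK; apply: GB => //; exact: pisoN. Qed.

Lemma piso_muln a b n : G (a, b) -> G (a *+ n, b *+ n).
Proof.
move=> Gab; elim: n => [|n IHn]; first exact: piso0.
by rewrite !mulrS; exact: (pisoD Gab IHn).
Qed.

Lemma pisoX a b n : G (a, b) -> G (a ^+ n, b ^+ n).
Proof.
move=> Gab; elim: n => [|n IHn]; first exact: G1.
by rewrite !exprS; exact: (GM Gab IHn).
Qed.

Lemma piso_sum (I : Type) (r : seq I) (E : I -> K) (F : I -> L) :
  (forall i, G (E i, F i)) -> G (\sum_(i <- r) E i, \sum_(i <- r) F i).
Proof.
move=> GEF; elim: r => [|i r IHr]; first by rewrite !big_nil; exact: piso0.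
by rewrite !big_cons; exact: (pisoD (GEF i) IHr).
Qed.

Lemma piso_eq0 a b : G (a, b) -> (a == 0) = (b == 0).
Proof. by move=> /Gsgz; rewrite -(sgz_eq0 a) -(sgz_eq0 b) => ->. Qed.

Lemma piso_gt0 a b : G (a, b) -> (0 < a) = (0 < b).
Proof. by move=> /Gsgz; rewrite -(sgz_gt0 a) -(sgz_gt0 b) => ->. Qed.

Lemma piso_lt a b c d : G (a, b) -> G (c, d) -> (a < c) = (b < d).
Proof.
by move=> Gu Gv; rewrite -subr_gt0 -[RHS]subr_gt0; exact: (piso_gt0 (GB Gv Gu)).
Qed.

Lemma piso_inj a b d : G (a, b) -> G (a, d) -> b = d.
Proof.
move=> Gu Gv; move: (piso_eq0 (GB Gu Gv)); rewrite subrr eqxx => /esym.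
by rewrite subr_eq0 => /eqP.
Qed.

(** * Polynomials with corresponding coefficients and their Tarski queries *)

Section Poly.
Implicit Types (p : {poly K}) (q : {poly L}).

Lemma prelC a b : G (a, b) -> poly_rel G a%:P b%:P.
Proof. by move=> Gab i; rewrite !coefC; case: eqP => _ //; exact: piso0. Qed.

Lemma prel1 : poly_rel G 1 1.
Proof. exact: (@prelC 1 1). Qed.

Lemma prelXn n : poly_rel G 'X^n 'X^n.
Proof. by move=> i; rewrite !coefXn; case: eqP => _ //; exact: piso0. Qed.

Lemma prelB p q p' q' :
  poly_rel G p q -> poly_rel G p' q' -> poly_rel G (p - p') (q - q').
Proof. by move=> pq pq' i; rewrite !coefB; exact: (GB (pq i) (pq' i)). Qed.

Lemma prelD p q p' q' :
  poly_rel G p q -> poly_rel G p' q' -> poly_rel G (p + p') (q + q').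
Proof. by move=> pq pq' i; rewrite !coefD; exact: (pisoD (pq i) (pq' i)). Qed.

Lemma prelM p q p' q' :
  poly_rel G p q -> poly_rel G p' q' -> poly_rel G (p * p') (q * q').
Proof.
by move=> pq pq' i; rewrite !coefM; apply: piso_sum => j;
  exact: (GM (pq j) (pq' _)).
Qed.

Lemma prelZ a b p q : G (a, b) -> poly_rel G p q ->
  poly_rel G (a *: p) (b *: q).
Proof. by move=> Gab pq; rewrite -!mul_polyC; exact/prelM/pq/prelC. Qed.

Lemma prelX p q n : poly_rel G p q -> poly_rel G (p ^+ n) (q ^+ n).
Proof.
by move=> pq; elim: n => [|n IHn]; [exact: prel1|rewrite !exprS; exact: prelM].
Qed.

Lemma prel_deriv p q : poly_rel G p q -> poly_rel G p^`() q^`().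
Proof. by move=> pq i; rewrite !coef_deriv; exact: piso_muln. Qed.

Lemma prel_size p q : poly_rel G p q -> size p = size q.
Proof.
move=> pq; apply/eqP; rewrite eqn_leq; apply/andP; split;
  apply/leq_sizeP => j /(@leq_sizeP _ _ _)/(_ j (leqnn j)) /eqP.
  by rewrite -(piso_eq0 (pq j)) => /eqP.
by rewrite (piso_eq0 (pq j)) => /eqP.
Qed.

Lemma prel_eq0 p q : poly_rel G p q -> (p == 0) = (q == 0).
Proof.
by move=> /prel_size pq; rewrite -(size_poly_eq0 p) -(size_poly_eq0 q) pq.
Qed.

Lemma prel_lead p q : poly_rel G p q -> G (lead_coef p, lead_coef q).
Proof. by move=> pq; rewrite !lead_coefE (prel_size pq); exact: pq. Qed.

Lemma prel_horner p q a b : poly_rel G p q -> G (a, b) -> G (p.[a], q.[b]).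
Proof.
move=> pq Gab; rewrite !horner_coef (prel_size pq).
by apply: piso_sum => i; exact: (GM (pq i) (pisoX i Gab)).
Qed.

Lemma prel_comp p q p' q' :
  poly_rel G p q -> poly_rel G p' q' -> poly_rel G (p \Po p') (q \Po q').
Proof.
move=> pq pq' i; rewrite !coef_comp_poly (prel_size pq).
by apply: piso_sum => j; exact: (GM (pq j) (prelX j pq' i)).
Qed.

(** Pseudo-division uses only ring operations and comparisons of sizes, so it takes the same
    branches on both sides. *)
Lemma prel_redivp p q p' q' : poly_rel G p q -> poly_rel G p' q' ->
  rscalp p p' = rscalp q q' /\
  poly_rel G (rmodp p p') (rmodp q q').
Proof.
move=> pq pq'; rewrite /rscalp /rmodp !unlock.
rewrite /redivp_expanded_def -(prel_eq0 pq').
case: eqP => // _; rewrite -(prel_size pq).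
(* The accumulated quotients [m] and [m'] may be arbitrary: they influence neither the exponent nor
   the remainder. *)
suff loop n k m m' : (redivp_rec p' k m p n).1.1 = (redivp_rec q' k m' q n).1.1
    /\ poly_rel G (redivp_rec p' k m p n).2 (redivp_rec q' k m' q n).2.
  exact: loop.
have step p1 q1 : poly_rel G p1 q1 ->
    poly_rel G (p1 * (lead_coef p')%:P - lead_coef p1 *: 'X^(size p1 - size
      p') * p')
               (q1 * (lead_coef q')%:P - lead_coef q1 *: 'X^(size p1 - size
                 p') * q').
  move=> pq1; apply: prelB; apply: prelM => //; first exact/prelC/prel_lead.
  by apply: prelZ; [exact: prel_lead|exact: prelXn].
elim: n k m m' p q pq => [|n IHn] k m m' p q pq /=;
  rewrite -(prel_size pq) -(prel_size pq'); case: ifP => // _.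
  by split=> //; exact: step.
by apply: IHn; exact: step.
Qed.

Lemma prel_next_mod p q p' q' : poly_rel G p q -> poly_rel G p' q' ->
  poly_rel G (next_mod p p') (next_mod q q').
Proof.
move=> pq pq'; rewrite /next_mod; have [-> mods] := prel_redivp pq pq'.
by apply: prelZ => //; exact: (pisoN (pisoX _ (prel_lead pq'))).
Qed.

(** The signs at the two infinities depend only on the size and on the sign of the leading
    coefficient. *)
Lemma prel_crossR p q : poly_rel G p q -> crossR p = crossR q.
Proof.
move=> pq; rewrite /crossR; apply: eq_variation.
  rewrite /sgp_minfty !(sgz_sgr, sgzM) (prel_size pq) (Gsgz (prel_lead pq)).
  by rewrite !sgzX !sgzN !sgz1.
by rewrite /sgp_pinfty !sgz_sgr (Gsgz (prel_lead pq)).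
Qed.

Lemma prel_changes_mods p q p' q' : poly_rel G p q -> poly_rel G p' q' ->
  changes_mods p p' = changes_mods q q'.
Proof.
(* Induction along the remainder sequence over [K]; the sequence over [L] follows it step by
   step. *)
elim: mods {-2}p {-2}p' (erefl (mods p p')) q q'
  => [|r s IHs] {}p {}p' modsE q q' pq pq'.
  move/eqP: modsE; rewrite mods_eq0 => p0.
  have /eqP-> : q == 0 by rewrite -(prel_eq0 pq).
  by rewrite (eqP p0) !changes_mods0p.
rewrite changes_mods_rec [RHS]changes_mods_rec (prel_crossR (prelM pq pq'));
  congr (_ + _).
apply: IHs => //; last exact: prel_next_mod.
by move: modsE; rewrite mods_rec; case: (p == 0) => // [] [].
Qed.

(** By the Sturm-Tarski theorem the query counts sign changes in the remainder sequence of [p] and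
    the derivative of [p] times [p']. *)
Lemma prel_taq p q p' q' : poly_rel G p q -> poly_rel G p' q' ->
  taq (rootsR p) p' = taq (rootsR q) q'.
Proof.
move=> pq pq'; rewrite !taq_taqR; apply: prel_changes_mods => //.
exact/prelM/pq'/prel_deriv.
Qed.

(* The factor (sign - c i)^2 vanishes exactly when the sign is c i, so these
   sums detect a root avoiding prescribed signs. *)
Lemma prel_weighted_taq (I : Type) (r : seq I) (A : I -> {poly K})
    (B : I -> {poly L}) (c : I -> int) p q p' q' :
  poly_rel G p q -> poly_rel G p' q' -> (forall i, poly_rel G (A i) (B i)) ->
  \sum_(x <- rootsR p) sgz p'.[x] * \prod_(i <- r) (sgz (A i).[x] - c i) ^+ 2 =
  \sum_(y <- rootsR q) sgz q'.[y] * \prod_(i <- r) (sgz (B i).[y] - c i) ^+ 2.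
Proof.
move=> pq pq' AB; elim: r p' q' pq' => [|i r IHr] p' q' pq'.
  under eq_bigr do rewrite big_nil mulr1.
  under [RHS]eq_bigr do rewrite big_nil mulr1.
  exact: prel_taq.
(* As [sgz] is multiplicative, expanding one square leaves three sums with one factor fewer,
   weighted by [h * C i ^+ 2], [h * C i] and [h]. *)
have expand (M : rcfType) (s : seq M) (C : I -> {poly M}) (h : {poly M}) :
    \sum_(x <- s) sgz h.[x] * \prod_(j <- i :: r) (sgz (C j).[x] - c j) ^+ 2 =
    \sum_(x <- s) sgz (h * C i ^+ 2).[x]
       * \prod_(j <- r) (sgz (C j).[x] - c j) ^+ 2
    - (c i *+ 2) * (\sum_(x <- s) sgz (h * C i).[x]
       * \prod_(j <- r) (sgz (C j).[x] - c j) ^+ 2)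
    + c i ^+ 2 * (\sum_(x <- s) sgz h.[x]
       * \prod_(j <- r) (sgz (C j).[x] - c j) ^+ 2).
  rewrite !mulr_sumr -sumrB -big_split /=; apply: eq_bigr => x _.
  by rewrite big_cons !hornerM !sgzM; ring.
rewrite !expand (IHr _ _ (prelM pq' (prelX 2 (AB i)))).
by rewrite (IHr _ _ (prelM pq' (AB i))) (IHr _ _ pq').
Qed.

(** Otherwise each [y] has a pair separating it from [z]. Prescribe in [prel_weighted_taq] the signs
    at the roots of [q]: over [L] each root kills its own factor, while over [K] the root [z]
    contributes a positive term to a sum of nonnegative ones. *)
Lemma realize_root_type p q z : poly_rel G p q -> p != 0 -> root p z ->
  exists y, forall p' q', poly_rel G p' q' -> sgz p'.[z] = sgz q'.[y].
Proof.
move=> pq p0 pz; apply: contrapT => noy.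
have /choice[AB ABP] : forall y : L, exists AB : {poly K} * {poly L},
    poly_rel G AB.1 AB.2 /\ sgz AB.1.[z] <> sgz AB.2.[y].
  move=> y; apply: contrapT => noAB; apply: noy; exists y => p' q' pq'.
  by apply: contrapT => neq; apply: noAB; exists (p', q').
have := prel_weighted_taq (rootsR q) (fun y => sgz (AB y).2.[y]) pq prel1
  (fun y => (ABP y).1).
rewrite [RHS]big1_seq => [|y /= yq]; last first.
  by rewrite (big_rem y) //= subrr expr0n /= mul0r mulr0.
have zp : z \in rootsR p by have := roots_on_rootsR p0 z; rewrite inE => <-.
apply/eqP; rewrite gt_eqF // (big_rem z) //= ltr_wpDr //.
  by apply: sumr_ge0 => x _; rewrite hornerE sgz1 mul1r prodr_ge0 // => y _;
    exact: sqr_ge0.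
rewrite hornerE sgz1 mul1r prodr_gt0 // => y _.
by rewrite exprn_even_gt0 //= subr_eq0; apply/eqP; case: (ABP y).
Qed.

End Poly.

Lemma sub_adjoin u : G `<=` adjoin G u.
Proof.
move=> [a b] Gab; exists a%:P, b%:P; split; first exact: prelC.
by rewrite !hornerC.
Qed.

Lemma mem_adjoin u : adjoin G u u.
Proof.
exists 'X, 'X; split; first exact: (prelXn 1).
by rewrite !hornerX; case: u.
Qed.

Lemma adjoin_iso x y :
  (forall p q, poly_rel G p q -> sgz p.[x] = sgz q.[y]) ->
  partial_iso (adjoin G (x, y)).
Proof.
move=> sgxy; split.
- exact/sub_adjoin/G1.
- move=> _ _ [p [q [pq ->]]] [p' [q' [pq' ->]]].
  by exists (p - p'), (q - q'); rewrite !hornerE; split=> //; exact: prelB.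
- move=> _ _ [p [q [pq ->]]] [p' [q' [pq' ->]]].
  by exists (p * p'), (q * q'); rewrite !hornerE; split=> //; exact: prelM.
- by move=> _ [p [q [pq ->]]]; exact: sgxy.
Qed.

End Rel.

Lemma bigcup_iso (F : set (set (K * L))) :
  F !=set0 -> (forall X, F X -> partial_iso X) -> total_on F subset ->
  partial_iso (\bigcup_(X in F) X).
Proof.
move=> [X0 FX0] isoF totF.
have join u v : (\bigcup_(X in F) X) u -> (\bigcup_(X in F) X) v ->
    exists X, [/\ F X, X u & X v].
  move=> [X FX Xu] [Y FY Yv].
  by have [XY|YX] := totF _ _ FX FY; [exists Y|exists X]; split=> //;
    [exact: XY|exact: YX].
split.
- by exists X0 => //; case: (isoF _ FX0).
- move=> u v Fu Fv; have [X [FX Xu Xv]] := join _ _ Fu Fv.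
  by exists X => //; case: (isoF _ FX) => _ + _ _; apply.
- move=> u v Fu Fv; have [X [FX Xu Xv]] := join _ _ Fu Fv.
  by exists X => //; case: (isoF _ FX) => _ _ + _; apply.
- by move=> u [X FX Xu]; case: (isoF _ FX) => _ _ _; apply.
Qed.

End PartialIso.

Definition flip (K L : Type) (G : set (K * L)) : set (L * K) :=
  [set u | G (u.2, u.1)].

Lemma flip_iso (K L : rcfType) (G : set (K * L)) :
  partial_iso G -> partial_iso (flip G).
Proof.
by case=> G1 GB GM Gs; split=> // [u v|u v|u]; [exact: GB|exact: GM|move/Gs].
Qed.

Lemma flip_poly_rel (K L : rcfType) (G : set (K * L)) p q :
  poly_rel G p q -> poly_rel (flip G) q p.
Proof. by []. Qed.

Definition root_closed (K L : rcfType) (G : set (K * L)) : Prop :=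
  forall p q z, poly_rel G p q -> p != 0 -> root p z -> exists y, G (z, y).

(** A root can be adjoined to [N] together with the partner given by [realize_root_type], so by
    maximality the pair is already in [N]; flipping gives the other side. *)
Lemma maximal_iso (K L : rcfType) (G : set (K * L)) : partial_iso G ->
  exists2 N : set (K * L), G `<=` N &
    [/\ partial_iso N, root_closed N & root_closed (flip N)].
Proof.
move=> isoG.
(* The condition is imposed on the union of [G] and [X], so that the empty chain is bounded too, by
   [G] itself. *)
have [F FP Ftot|N0 [isoN maxN]] :=
  @Zorn_bigcup _ [set X : set (K * L) | partial_iso (G `|` X)].
  have [->|/set0P[X0 FX0]] := eqVneq F set0.
    by rewrite /= bigcup_set0 setU0.
  rewrite /= -bigcupUr; last by exists X0.
  rewrite -(bigcup_image F (fun X => G `|` X) idfun).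
  apply: bigcup_iso; first by exists (G `|` X0), X0.
  - by move=> _ [X FX <-]; exact: FP.
  - move=> _ _ [X FX <-] [Y FY <-].
    by have [XY|YX] := Ftot _ _ FX FY; [left|right]; exact: setUS.
set N := G `|` N0 in isoN; have GN : G `<=` N by left.
have maxN' H : partial_iso H -> N `<=` H -> H `<=` N.
  move=> isoH NH; apply: contrapT => HN.
  apply: (maxN H); last by rewrite /= setUidr //; exact: subset_trans GN NH.
  split; last by move=> HN0; apply: HN => u /HN0; right.
  by move=> u N0u; apply: NH; right.
exists N => //; split=> //.
- move=> p q z pq p0 pz; have [y zy] := realize_root_type isoN pq p0 pz.
  exists y; apply: (maxN' (adjoin N (z, y))); last exact: mem_adjoin.
    exact: adjoin_iso.
  exact: sub_adjoin.
- move=> p q z pq p0 pz.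
  have isoN' := flip_iso isoN.
  have [y zy] := realize_root_type isoN' pq p0 pz.
  exists y; apply: (maxN' (flip (adjoin (flip N) (z, y)))).
  + exact/flip_iso/adjoin_iso.
  + by move=> [a b] Nab; exact: (sub_adjoin isoN').
  + exact: (mem_adjoin isoN').
Qed.

(** * Cardinalities at most that of the continuum *)

(* A surjection from [set nat], rather than an injection into R, makes the
   closure properties (unions, finite sequences) direct. *)
Definition small (T : Type) (A : set T) : Prop :=
  exists f : set nat -> T, A `<=` range f.

Lemma small_sub T (A B : set T) : A `<=` B -> small B -> small A.
Proof. by move=> AB [f Bf]; exists f; exact: subset_trans AB Bf. Qed.

Lemma small_image T U (g : T -> U) (A : set T) : small A -> small (g @` A).
Proof.
move=> [f Af]; exists (g \o f) => _ [a /Af[X _ <-] <-].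
by exists X.
Qed.

Lemma small_nat : small [set: nat].
Proof.
exists (fun X => xget 0%N X) => n _; exists [set n] => //.
by case: xgetP => [y _ ->|/(_ n) []].
Qed.

(** A sequence of subsets of the naturals is coded by one subset, the codes of the pairs [(i, m)]
    with [m] in the [i]-th set. *)
Lemma small_funs T (A : set T) : small A -> small [set s : nat ->
  T | forall i, A (s i)].
Proof.
move=> [f Af]; exists (fun X i => f [set m | X (pickle (i, m))]) => s As.
have /choice[e es] : forall i, exists Y, f Y = s i.
  by move=> i; have [Y _ fY] := Af _ (As i); exists Y.
exists [set n | exists i m, n = pickle (i, m) /\ e i m] => //.
apply/funext => i; rewrite -es; congr f; apply/seteqP; split=> m /=.
  by move=> [j [k [/(pcan_inj pickleK) [-> ->]]]].
by move=> eim; exists i, m.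
Qed.

Lemma small_prod T U (A : set T) (B : set U) :
  small A -> small B -> small (A `*` B).
Proof.
move=> [f Af] [g Bg].
have [h hP] : small [set s : nat -> set nat | forall i, [set: set nat] (s i)].
  by apply: small_funs; exists id => X _; exists X.
exists (fun X => (f (h X 0%N),
  g (h X 1%N))) => -[a b] [/= /Af[X _ <-] /Bg[Y _ <-]].
have [//|Z _ hZ] := hP (fun i => if i is 0%N then X else Y).
by exists Z; rewrite //= hZ.
Qed.

(** A list is recovered from its length and its entries, padded to an infinite sequence by an
    element of [A]. *)
Lemma small_seq (T : eqType) (A : set T) :
  small A -> small [set s : seq T | {in s, forall x, A x}].
Proof.
(* Without an element to pad with, only the empty list remains. *)
move=> smallA; have [->|/set0P[a Aa]] := eqVneq A set0.
  exists (fun=> [::]) => -[|x s] /=; last by move=> /(_ x); rewrite inE eqxx;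
    case.
  by exists set0.
apply: small_sub (small_image (fun u => mkseq u.2 u.1)
  (small_prod small_nat (small_funs smallA))) => s As.
exists (size s, nth a s); last by rewrite /= mkseq_nth.
split=> //= i; have [ilt|ige] := ltnP i (size s); first exact/As/mem_nth.
by rewrite nth_default.
Qed.

Lemma small_bigcup T I (D : set I) (F : I -> set T) :
  T -> small D -> (forall i, D i -> small (F i)) ->
    small (\bigcup_(i in D) F i).
Proof.
move=> a smallD smallF.
have /choice[e eP] : forall i, exists f : set nat -> T, D i -> F i `<=` range f.
  move=> i; have [Di|nDi] := pselect (D i); last by exists (fun=> a).
  by have [f Ff] := smallF _ Di; exists f.
apply: small_sub (small_image (fun u => e u.1 u.2)
  (small_prod smallD (_ : small [set: set nat]))).
  move=> x [i Di /(eP _ Di)[X _ eX]].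
  by exists (i, X).
by exists id => X _; exists X.
Qed.

Lemma card_le_inj T U (A : set T) (B : set U) : U -> A #<= B ->
  exists f : T -> U, (forall x, A x -> B (f x)) /\ {in A &, injective f}.
Proof.
move=> b /card_leP[f].
exists (fun x => if pselect (A x) is left Ax
  then set_val (f (SigSub (mem_set Ax))) else b).
split=> [x Ax|x y].
  by case: pselect => // Ax'; exact: set_valP.
rewrite !inE => Ax Ay; case: pselect => // Ax'; case: pselect => // Ay'.
move=> /val_inj /(inj (in_setT _) (in_setT _)).
by move=> /(congr1 set_val).
Qed.

Lemma inj_card_leP T U (A : set T) (B : set U) (f : T -> U) :
  (forall x, A x -> B (f x)) -> {in A &, injective f} -> A #<= B.
Proof.
move=> fAB finj; have [g] : $|{injfun A >-> B}| by apply/injfunPex; exists f.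
exact: (inj_card_le g).
Qed.

(** * The reals and the subsets of the naturals *)

Section Continuum.
Variable R : realType.

(** A real is determined by the set of rationals below it, hence by a set of naturals. *)
Lemma card_le_small (T : choiceType) (A : set T) : T -> A #<= [set: R] ->
  small A.
Proof.
move=> a /(card_le_inj (0 : R))[f [_ finj]].
pose cut (r : R) : set nat := pickle @` [set q : rat | ratr q < r].
have cut_inj : injective cut.
  suff cut_lt r t : r < t -> cut r <> cut t.
    move=> r t rt; apply/eqP; rewrite eq_le !leNgt.
    by apply/andP; split; apply/negP => /cut_lt; rewrite rt.
  move=> /rat_in_itvoo[q /itvP qrt] /seteqP[_ /(_ (pickle q))].
  case; first by exists q => //=; rewrite qrt.
  by move=> q' /= q'r /(pcan_inj pickleK) q'q; move: q'r; rewrite q'q ltNge qrt.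
exists (fun X => xget a [set x | A x /\ cut (f x) = X]) => x Ax.
exists (cut (f x)) => //; case: xgetP => [y _ [Ay /cut_inj fyx]|/(_ x) []].
  by apply: finj; rewrite ?inE.
by split.
Qed.

(** Base 3 with digits 0 and 1 only, which rules out double expansions. *)
Let psum (X : set nat) n : R := \sum_(i < n) (`[< X i >])%:R / 3 ^+ i.

Lemma psum_homo X m n : (m <= n)%N -> psum X m <= psum X n.
Proof.
elim: n => [|n IHn]; first by rewrite leqn0 => /eqP ->.
rewrite leq_eqVlt ltnS => /predU1P[->//|/IHn/le_trans]; apply.
by rewrite /psum big_ord_recr /= lerDl divr_ge0 // exprn_ge0.
Qed.

(** The term [3 / 2 / 3 ^+ n] is the sum of [3 ^- i] over all [i >= n], the most that the remaining
    digits can add. *)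
Lemma psum_tail X m n : (m <= n)%N ->
  psum X n + 3 / 2 / 3 ^+ n <= psum X m + 3 / 2 / 3 ^+ m.
Proof.
elim: n => [|n IHn]; first by rewrite leqn0 => /eqP ->.
rewrite leq_eqVlt ltnS => /predU1P[->//|/IHn]; apply: le_trans.
rewrite /psum big_ord_recr /= -addrA lerD2l exprS.
have p0 : 0 < 3 ^+ n :> R by rewrite exprn_gt0.
have -> : 3 / 2 / (3 * 3 ^+ n) = (1 / 2) / 3 ^+ n :> R.
  by field; rewrite gt_eqF.
rewrite -mulrDl ler_pM2r ?invr_gt0 //.
by case: asboolP => _ /=; rewrite ?mulr1n ?mulr0n; lra.
Qed.

(** This embedding lets Cantor completeness be applied to families indexed by [set nat]. *)
Definition ternary (X : set nat) : R := sup (range (psum X)).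

Lemma has_sup_psum X : has_sup (range (psum X)).
Proof.
split; first by exists (psum X 0), 0%N.
exists (psum X 0 + 3 / 2 / 3 ^+ 0) => _ [n _ <-].
by rewrite (le_trans _ (psum_tail X (leq0n n))) // lerDl !divr_ge0 // exprn_ge0.
Qed.

Lemma psum_le_ternary X n : psum X n <= ternary X.
Proof. by apply: sup_upper_bound; [exact: has_sup_psum|exists n]. Qed.

Lemma ternary_le X n : ternary X <= psum X n + 3 / 2 / 3 ^+ n.
Proof.
apply: sup_le_ub; first by exists (psum X 0), 0%N.
move=> _ [m _ <-]; apply: le_trans (psum_homo X (leq_maxl m n)) _.
apply: le_trans (psum_tail X (leq_maxr m n)).
by rewrite lerDl !divr_ge0 // exprn_ge0.
Qed.

(** The digit at [n] is worth [3 ^- n], and all later digits of [X] together add at most half of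
    that. *)
Lemma ternary_lt X Y n : (forall i, (i < n)%N -> X i <-> Y i) ->
  ~ X n -> Y n -> ternary X < ternary Y.
Proof.
move=> XY nXn Yn; apply: le_lt_trans (ternary_le X n.+1) _.
apply: lt_le_trans (psum_le_ternary Y n.+1).
rewrite /psum !big_ord_recr /= (asboolF nXn) (asboolT Yn) mul0r addr0 mul1r.
rewrite (eq_bigr (fun i : 'I_n => (`[< Y i >])%:R / 3 ^+ i)) => [|i _].
  have p0 : 0 < 3 ^+ n :> R by rewrite exprn_gt0.
  rewrite ltrD2l exprS.
  have -> : 3 / 2 / (3 * 3 ^+ n) = (1 / 2) / 3 ^+ n :> R.
    by field; rewrite gt_eqF.
  by rewrite gtr_pMl ?invr_gt0 // ltr_pdivrMr // mul1r ltr1n.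
by rewrite (asbool_equiv_eq (XY i (ltn_ord i))).
Qed.

Lemma ternary_inj : injective ternary.
Proof.
move=> X Y tXY; apply: contrapT => neXY.
have diff : exists n, `[< X n >] != `[< Y n >].
  apply: contrapT => nd; apply: neXY; apply/seteqP; split=> n.
    by apply: contraPP => nYn XYn; apply: nd; exists n;
      rewrite (asboolT XYn) (asboolF nYn).
  by apply: contraPP => nXn XYn; apply: nd; exists n;
    rewrite (asboolT XYn) (asboolF nXn).
case: (ex_minnP diff) => n neq minn.
have agree i : (i < n)%N -> X i <-> Y i.
  move=> ilt; apply: asbool_eq_equiv; apply/eqP.
  by apply: contraLR ilt => /minn; rewrite -leqNgt.
move: neq; case: asboolP => Xn; case: asboolP => Yn // _.
  by have := ternary_lt (fun i ilt => iff_sym (agree i ilt)) Yn Xn;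
    rewrite tXY ltxx.
by have := ternary_lt agree Xn Yn; rewrite tXY ltxx.
Qed.

End Continuum.

(** * The one-point extension *)

Lemma small_poly_rel (K L : rcfType) (G : set (K * L)) :
  small G -> small [set pq : {poly K} * {poly L} | poly_rel G pq.1 pq.2].
Proof.
move=> smallG; apply: small_sub (small_image (fun s : seq (K * L) =>
  (Poly (map fst s), Poly (map snd s))) (small_seq smallG)) => -[p q] /= pq.
pose n := maxn (size p) (size q).
exists (mkseq (fun i => (p`_i, q`_i)) n) => [_ /mapP[i _ ->]|]; first exact: pq.
congr (_, _); apply/polyP => i; rewrite coef_Poly -map_comp;
  have [ilt|ige] := ltnP i n.
- by rewrite nth_mkseq.
- rewrite !nth_default ?size_mkseq //.
  by rewrite (leq_trans _ ige) // leq_maxl.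
- by rewrite nth_mkseq.
- rewrite !nth_default ?size_mkseq //.
  by rewrite (leq_trans _ ige) // leq_maxr.
Qed.

Lemma small_adjoin (K L : rcfType) (G : set (K * L)) u :
  small G -> small (adjoin G u).
Proof.
move=> /small_poly_rel smallP.
apply: small_sub (small_image (fun pq => (pq.1.[u.1], pq.2.[u.2])) smallP).
by move=> _ [p [q [pq ->]]]; exists (p, q).
Qed.

(** The two roots need not correspond to each other; intersecting with a maximal [N] later selects
    the matching pairs. *)
Definition root_pairs (K L : rcfType) (G : set (K * L)) : set (K * L) :=
  [set u | exists p q, [/\ poly_rel G p q, p != 0, q != 0,
                           root p u.1 & root q u.2]].

Lemma small_root_pairs (K L : rcfType) (G : set (K * L)) :
  small G -> small (root_pairs G).
Proof.
move=> /small_poly_rel smallP.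
apply: small_sub (small_image
  (fun t : _ * (nat * nat) => ((rootsR t.1.1)`_t.2.1, (rootsR t.1.2)`_t.2.2))
  (small_prod smallP (small_prod small_nat small_nat))).
move=> [a b] [p [q [pq p0 q0 /= pa qb]]].
have ap : a \in rootsR p by rewrite -(roots_on_rootsR p0) inE.
have bq : b \in rootsR q by rewrite -(roots_on_rootsR q0) inE.
by exists ((p, q), (index a (rootsR p), index b (rootsR q)));
  rewrite //= !nth_index.
Qed.

(** The largest of finitely many left endpoints lies in all the intervals. *)
Lemma finite_interval_meet (L : rcfType) (I : eqType) (a b : I ->
  L) (D : set I) :
  I -> (forall i j, a i <= b j) -> finite_set D ->
  \bigcap_(i in D) `[a i, b i]%classic !=set0.
Proof.
move=> i0 ab /finite_seqP[s ->].
suff [m [am mb]] : exists m, (forall i, i \in s -> a i <= m) /\ (forall j,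
  m <= b j).
  by exists m => i /= /am ai; rewrite in_itv /= ai mb.
elim: s => [|i s [m [am mb]]]; first by exists (a i0); split.
exists (Order.max (a i) m); split=> [k|j]; last by rewrite ge_max ab mb.
by rewrite le_max inE => /predU1P[->|/am ->]; rewrite ?lexx ?orbT.
Qed.

(** Meant for the list of roots of a polynomial; [l0] is the fallback when no entry lies below
    [x]. *)
Lemma nearest_below (K : realDomainType) (P : K -> Prop) (r : seq K) l0 x :
  P l0 -> l0 < x -> {in r, forall a, P a} ->
  exists l, [/\ P l, l < x & {in r, forall a, a < x -> a <= l}].
Proof.
move=> Pl0 l0x; elim: r => [|a r IHr] Pr; first by exists l0.
have [|l [Pl lx l_max]] := IHr; first by move=> b br; apply: Pr;
  rewrite inE br orbT.
have Pa : P a by apply: Pr; rewrite mem_head.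
have [ax|xa] := ltP a x; last first.
  by exists l; split=> // b /predU1P[->|/l_max//]; rewrite ltNge xa.
have [la|al] := leP l a; last first.
  by exists l; split=> // b /predU1P[->|/l_max//]; rewrite (ltW al).
exists a; split=> // b /predU1P[->//|/l_max bl /bl].
by move=> /le_trans; apply.
Qed.

Lemma nearest_above (K : realDomainType) (P : K -> Prop) (r : seq K) h0 x :
  P h0 -> x < h0 -> {in r, forall a, P a} ->
  exists h, [/\ P h, x < h & {in r, forall a, x < a -> h <= a}].
Proof.
move=> Ph0 xh0 Pr.
have [||_ /mapP[a ar ->]|l [Pl lx l_max]] :=
    @nearest_below K (P \o -%R) (map -%R r) (- h0) (- x).
- by rewrite /= opprK.
- by rewrite ltrN2.
- by rewrite /= opprK; exact: Pr.
exists (- l); rewrite ltrNr; split=> // a ar xa.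
by rewrite lerNl l_max ?ltrN2 ?map_f.
Qed.

Section Extension.
Variables (R : realType) (K L : rcfType).
Hypothesis completeL : Cantor_complete L R.

(** By monotonicity every left endpoint is below every right endpoint, so finitely many of the
    intervals meet and completeness gives [y]. *)
Lemma cut_meet (A : set (K * L)) x : small A ->
  (forall u v, A u -> A v -> u.1 < v.1 -> u.2 < v.2) ->
  (exists2 l, A l & l.1 < x) -> (exists2 r, A r & x < r.1) ->
  exists y, forall u, A u -> (u.1 < x -> u.2 <= y) /\ (x < u.1 -> y <= u.2).
Proof.
move=> [e Ae] mono [l Al lx] [r Ar xr].
(* Each [e X] bounds from at most one side; the fixed [l.2] and [r.2] supply the missing
   endpoints. *)
pose lo X := if `[< A (e X) /\ (e X).1 < x >] then (e X).2 else l.2.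
pose up X := if `[< A (e X) /\ x < (e X).1 >] then (e X).2 else r.2.
have loP X : exists u, [/\ A u, u.1 < x & lo X = u.2].
  by rewrite /lo; case: asboolP => [[AX ltX]|_]; [exists (e X)|exists l].
have upP X : exists u, [/\ A u, x < u.1 & up X = u.2].
  by rewrite /up; case: asboolP => [[AX ltX]|_]; [exists (e X)|exists r].
have loup X Y : lo X <= up Y.
  have [u [Au ux ->]] := loP X; have [v [Av xv ->]] := upP Y.
  exact/ltW/mono/lt_trans/xv.
have [||y yP] := @completeL (set nat) lo up.
- by apply: (inj_card_leP (f := @ternary R)) => // X Y _ _; exact: ternary_inj.
- by move=> D; apply: finite_interval_meet => //; exact: set0.
exists y => u Au; have [X _ eX] := Ae _ Au.
have /= := yP X I; rewrite in_itv /= /lo /up eX => /andP[lo_y y_up]; split=> ux.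
  by move: lo_y; case: asboolP => // -[].
by move: y_up; case: asboolP => // -[].
Qed.


Variable G : set (K * L).
Variables (s : K) (t : L).
Hypotheses (isoG : partial_iso G) (smallG : small G) (Gst : G (s, t)).
Hypothesis scale_s : infinitesimal_scale s.

Let s_gt0 : 0 < s. Proof. by case: scale_s. Qed.

Lemma scale_large x : exists n, x < s ^- n.
Proof.
case: scale_s => _ _ nub; apply: contrapT => nlarge; apply: nub.
exists x => _ [n _ <-]; rewrite leNgt; apply/negP => xn.
by apply: nlarge; exists n.
Qed.

Lemma scale_small d : 0 < d -> exists n, s ^+ n < d.
Proof.
move=> d0; have [n dn] := scale_large d^-1; exists n.
by rewrite -ltf_pV2 ?posrE ?exprn_gt0.
Qed.

Lemma extend_type x :
  exists y, forall p q, poly_rel G p q -> sgz p.[x] = sgz q.[y].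
Proof.
have [N GN [isoN closedN closedN']] := maximal_iso isoG.
have prelN p q : poly_rel G p q -> poly_rel N p q by exact: poly_relS.
have [[y Nxy]|noy] := pselect (exists y, N (x, y)).
  exists y => p q /prelN pq; have := prel_horner isoN pq Nxy.
  by case: isoN => _ _ _ /[apply].
have [N1 NB NM Nsgz] := isoN.
have ND u v : N u -> N v -> N (u + v) by exact: pisoD.
have Nlt (u v : K * L) : N u -> N v -> (u.1 < v.1) = (u.2 < v.2).
  by case: u v => [a b] [c d]; exact: piso_lt.
have Nst n : N (s ^+ n, t ^+ n) by apply: pisoX => //; exact: GN.
(* The algebraic part of [N] over [G]: small because [G] is, whereas [N] may be too large for
   completeness. *)
pose A := [set u | N u /\ root_pairs G u].
have mem_A p q a : poly_rel G p q -> p != 0 -> root p a -> exists b, A (a, b).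
  move=> pq p0 pa; have [b Nab] := closedN _ _ _ (prelN _ _ pq) p0 pa.
  exists b; split=> //; exists p, q; split=> //=;
    first by rewrite -(prel_eq0 isoG pq).
  by have := prel_horner isoN (prelN _ _ pq) Nab; rewrite /root => /piso_eq0 <-.
(* A root of [p] translated by [c] is a root of [p] composed with ['X - c%:P]. *)
have A_shift u v : A u -> G v -> A (u + v).
  case: u v => [a b] [c d] [Nu [p [q [pq p0 q0 /= pa qb]]]] Gv.
  split; first exact: (ND _ _ Nu (GN _ Gv)).
  have XC : poly_rel G ('X - c%:P) ('X - d%:P).
    by apply: (prelB isoG); [exact: (prelXn isoG 1)|exact: prelC].
  exists (p \Po ('X - c%:P)), (q \Po ('X - d%:P)); split => /=.
  - exact: prel_comp.
  - by rewrite -size_poly_eq0 size_comp_poly2 ?size_XsubC // size_poly_eq0.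
  - by rewrite -size_poly_eq0 size_comp_poly2 ?size_XsubC // size_poly_eq0.
  - by rewrite /root horner_comp !hornerE addrK.
  - by rewrite /root horner_comp !hornerE addrK.
have Gs n : G (s ^+ n, t ^+ n) by exact: pisoX.
(* [G] is only a ring, so bounds of the form [s ^- n], up to sign, enter [A] as roots of linear
   polynomials over [G]. *)
have [lo Alo lox] : exists2 l, A l & l.1 < x.
  have [n xn] := scale_large (- x).
  have [|||b Ab] := @mem_A (s ^+ n *: 'X + 1) (t ^+ n *: 'X + 1) (- s ^- n).
  - by apply: (prelD isoG); [exact: prelZ (Gs n) (prelXn isoG 1)|exact: prel1].
  - apply/eqP => /(congr1 (fun r => r.[0])) /eqP.
    by rewrite !hornerE ?mulr0 ?add0r ?sub0r oner_eq0.
  - by rewrite /root !hornerE mulrN mulfV ?addNr // expf_neq0 ?gt_eqF.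
  by exists (- s ^- n, b); rewrite //= ltrNl.
have [hi Ahi xhi] : exists2 r, A r & x < r.1.
  have [n xn] := scale_large x.
  have [|||b Ab] := @mem_A (s ^+ n *: 'X - 1) (t ^+ n *: 'X - 1) (s ^- n).
  - by apply: (prelB isoG); [exact: prelZ (Gs n) (prelXn isoG 1)|exact: prel1].
  - apply/eqP => /(congr1 (fun r => r.[0])) /eqP.
    by rewrite !hornerE ?mulr0 ?add0r ?sub0r oppr_eq0 oner_eq0.
  - by rewrite /root !hornerE mulfV ?subrr // expf_neq0 ?gt_eqF.
  by exists (s ^- n, b).
have smallA : small A by apply: small_sub (small_root_pairs smallG) => u [].
have [|||y yP] := @cut_meet A x smallA.
- by move=> u v [Nu _] [Nv _]; rewrite Nlt.
- by exists lo.
- by exists hi.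
have t_gt0 n : 0 < t ^+ n by rewrite -(piso_gt0 isoN (Nst n)) exprn_gt0.
(* No element of A is adjacent to the cut: its translates by powers of the
   scale lie in A as well. *)
have lt_y u : A u -> u.1 < x -> u.2 < y.
  move=> Au ux; have [n sn] : exists n, s ^+ n < x - u.1.
    by apply: scale_small; rewrite subr_gt0.
  have [+ _] := yP _ (A_shift _ _ Au (Gs n)).
  by rewrite /= -ltrBrDl => /(_ sn); apply: lt_le_trans; rewrite ltrDl.
have gt_y u : A u -> x < u.1 -> y < u.2.
  move=> Au xu; have [n sn] : exists n, s ^+ n < u.1 - x.
    by apply: scale_small; rewrite subr_gt0.
  have [_ ub] := yP _ (A_shift _ _ Au (pisoN isoG (Gs n))).
  apply: le_lt_trans (ub _) _; rewrite /=; first by rewrite ltrBrDr -ltrBrDl.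
  by rewrite gtrDl oppr_lt0.
exists y => p q pq; have [p0|p0] := eqVneq p 0.
  by move: (prel_eq0 isoG pq); rewrite p0 eqxx => /esym/eqP ->;
    rewrite !horner0 !sgz0.
have q0 : q != 0 by rewrite -(prel_eq0 isoG pq).
have root_mem a : root p a = (a \in rootsR p) by rewrite -(roots_on_rootsR
  p0) inE.
have rootsA : {in rootsR p, forall a, exists b, A (a, b)}.
  by move=> a; rewrite -root_mem; exact: mem_A.
have [l [[l' All] lx l_max]] :
    exists l, [/\ exists b, A (l, b), l < x & {in rootsR p, forall a,
      a < x -> a <= l}].
  by apply: (nearest_below (l0 := lo.1)) => //; exists lo.2; case: (lo) Alo.
have [h [[h' Ahh] xh h_min]] :
    exists h, [/\ exists b, A (h, b), x < h & {in rootsR p, forall a,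
      x < a -> h <= a}].
  by apply: (nearest_above (h0 := hi.1)) => //; exists hi.2; case: (hi) Ahi.
(* A root at [x] itself would put [x] into the domain of [N], against [noy]. *)
have no_root : {in `]l, h[, forall a, ~~ root p a}.
  move=> a; rewrite in_itv /= => /andP[la ah]; apply/negP => pa.
  have [ax|xa|ax] := ltgtP a x.
  - by move: la; rewrite ltNge l_max // -root_mem.
  - by move: ah; rewrite ltNge h_min // -root_mem.
  - by apply: noy; have [b [Nxb _]] := mem_A _ _ _ pq p0 pa; exists b;
    rewrite -ax.
(* A root of [q] here would be carried back by [N] to a root of [p] between [l] and [h]. *)
have no_root' : {in `]l', h'[, forall b, ~~ root q b}.
  move=> b; rewrite in_itv /= => /andP[lb bh]; apply/negP => qb.
  have [a Nab] := closedN' _ _ _ (flip_poly_rel (prelN _ _ pq)) q0 qb.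
  have /negP[] : ~~ root p a.
    apply: no_root; rewrite in_itv /= (Nlt (l, l') (a, b) All.1 Nab).
    by rewrite (Nlt (a, b) (h, h') Nab Ahh.1) lb.
  have := prel_horner isoN (prelN _ _ pq) Nab;
    rewrite /root => /(piso_eq0 isoN) ->.
  exact: qb.
(* The pair of [x] and [y] is not in [N], so the signs are compared through the midpoint, which [N]
   contains by root closure: [p] and [q] keep constant signs on the two intervals. *)
pose mid := (l + h) / 2.
have Nl := All.1; have Nh := Ahh.1.
have [|||mid' Nmid] := closedN ('X + 'X - (l + h)%:P) ('X + 'X - (l' +
  h')%:P) mid.
- apply: (prelB isoN); last exact: (prelC isoN (ND _ _ Nl Nh)).
  by apply: (prelD isoN); exact: (prelXn isoN 1).
- apply/eqP => /(congr1 (fun r => r.[1] - r.[0])).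
  by rewrite !hornerE; lra.
- by rewrite /root !hornerE -splitr subrr.
have l_mid : l < mid by rewrite /mid; lra.
have mid_h : mid < h by rewrite /mid; lra.
have l_mid' : l' < mid' by rewrite -(Nlt _ _ Nl Nmid).
have mid_h' : mid' < h' by rewrite -(Nlt _ _ Nmid Nh).
have midP := Nsgz _ (prel_horner isoN (prelN _ _ pq) Nmid).
have -> : sgz p.[x] = sgz p.[mid].
  rewrite -sgz_sgr -[RHS]sgz_sgr; congr sgz.
  by apply: (polyrN0_itv no_root); rewrite in_itv /= ?lx ?l_mid.
rewrite midP -sgz_sgr -[RHS]sgz_sgr; congr sgz.
apply: (polyrN0_itv no_root'); rewrite in_itv /= ?l_mid' //.
by rewrite (lt_y _ All lx) (gt_y _ Ahh xh).
Qed.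

Lemma extend_iso x : exists2 H : set (K * L), G `<=` H &
  [/\ partial_iso H, small H & exists y, H (x, y)].
Proof.
have [y xy] := extend_type x; exists (adjoin G (x, y)); first exact: sub_adjoin.
by split; [exact: adjoin_iso|exact: small_adjoin|exists y; exact: mem_adjoin].
Qed.

End Extension.

(** * Well-orderings, scales and total partial isomorphisms *)

Lemma small_setU T (A B : set T) : T -> small A -> small B -> small (A `|` B).
Proof.
move=> a smallA smallB.
apply: small_sub (small_bigcup (F :=
  fun i => if i is 0%N then A else B) a small_nat _).
  by move=> x [Ax|Bx]; [exists 0%N|exists 1%N].
by case.
Qed.

Lemma small_countable (T : countType) : T -> small [set: T].
Proof.
move=> a; apply: small_sub (small_image (fun n => odflt a (unpickle n))
  small_nat).
by move=> x _; exists (pickle x); rewrite //= pickleK.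
Qed.

Lemma small_preimage (T : choiceType) U (h : T -> U) (A : set U) :
  T -> injective h -> small A -> small (h @^-1` A).
Proof.
move=> a hinj [f Af]; exists (fun X => xget a [set x | h x = f X]) => x /Af[X
  _ fX].
by exists X => //; case: xgetP => [y _ /=|/(_ x)[]//]; rewrite fX => /hinj.
Qed.

(** If some initial segment of a well-order of [K] is not small, take the least [m] bounding one.
    Minimality of the cardinality of [K] injects [K] into the segment below [m], and the order
    pulled back along this injection has small segments. *)
Lemma card_succ_well_order (R : realType) (K : choiceType) :
  K -> card_succ K R -> exists lt : K -> K -> Prop,
    [/\ well_founded lt, forall x y, [\/ lt x y, x = y | lt y x] &
        forall x, small [set y | lt y x]].
Proof.
move=> k0 [_ _ leastK]; have [W woW] := well_ordering_principle K.
(* [W] is known only through unique least elements: singletons give reflexivity, pairs give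
   antisymmetry. *)
have reflW x : W x x.
  have [|z [[/eqP zx +] _]] := woW (pred1 x); first by exists x; rewrite inE.
  by rewrite zx; apply; rewrite inE.
have antiW x y : W x y -> W y x -> x = y.
  move=> xy yx; have [|z [_ uz]] := woW (pred2 x y); first by exists x;
    rewrite !inE eqxx.
  rewrite -(uz x) ?(uz y) //; split; rewrite ?inE ?eqxx ?orbT // => w;
    by rewrite inE => /orP[]/eqP ->.
pose lt0 x y := W x y /\ x <> y.
have min0 (P : K -> Prop) x : P x -> exists2 z, P z & forall y, P y -> W z y.
  move=> Px; have [|z [[Pz zmin] _]] := woW [pred y | `[< P y >]].
    by exists x; apply/asboolP.
  exists z; first exact/asboolP.
  by move=> y Py; apply: zmin; apply/asboolP.
have wf0 : well_founded lt0.
  move=> x; apply: contrapT => /(min0 (fun y => ~ Acc lt0 y))[z nz zmin].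
  apply: nz; constructor => y [yz ney]; apply: contrapT => /zmin zy.
  exact/ney/antiW.
have tri0 x y : [\/ lt0 x y, x = y | lt0 y x].
  have [->|/eqP nxy] := eqVneq x y; first by constructor 2.
  have [|z [->|->] zmin] := min0 (fun z => z = x \/ z = y) x; first by left.
    by constructor 1; split=> //; apply: zmin; right.
  by constructor 3; split; [apply: zmin; left|exact: nesym].
have [[x0 x0P]|allsmall] := pselect (exists x, ~ small [set y | lt0 y x]);
  last first.
  exists lt0; split=> // x; apply: contrapT => nx; apply: allsmall; by exists x.
have [m nsmall mmin] := min0 (fun x => ~ small [set y | lt0 y x]) _ x0P.
have /leastK : ~ ([set: [set y | lt0 y m]] #<= [set: R]).
  move=> le_mR; apply: nsmall; apply: (@card_le_small R) => //.
  by apply: card_le_trans le_mR; have := card_setT [set y | lt0 y m];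
    rewrite card_eq_le => /andP[].
have := card_setT [set y | lt0 y m]; rewrite card_eq_le => /andP[le_m _].
move=> /card_le_trans/(_ le_m) /(card_le_inj k0)[h [hm hinj]].
have {}hinj : injective h by move=> x y; apply: hinj; rewrite inE.
exists (fun x y => lt0 (h x) (h y)); split=> [|x y|x].
- exact: wf_inverse_image wf0.
- by have [|/hinj|] := tri0 (h x) (h y);
  [constructor 1|constructor 2|constructor 3].
- apply: (@small_preimage _ _ h [set y | lt0 y (h x)] k0 hinj).
  apply: contrapT => /mmin mx; have [xm nex] := hm x I.
  exact/nex/antiW.
Qed.

(** * The initial subring generated by a pair of scales *)

Section Base.
Variable K : rcfType.

(** An integer polynomial is finite at an infinitesimal, and a finite element times an infinitesimal
    is infinitesimal. *)
Lemma infinitesimal_horner_lt1 (s : K) (p : {poly int}) :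
  infinitesimal s -> `|(map_poly intr p).[s] * s| < 1.
Proof.
move=> infs; have s1 : `|s| < 1 by have := infs 1%N isT; rewrite invr1.
have [n n0 pn] : exists2 n, (0 < n)%N & `|(map_poly intr p).[s]| <= n%:R.
  elim/poly_ind: p => [|p c [n n0 pn]]; first by exists 1%N;
    rewrite // rmorph0 horner0 normr0.
  exists (n + `|c|)%N; first by rewrite addn_gt0 n0.
  rewrite rmorphD rmorphM /= map_polyX map_polyC /= hornerMXaddC.
  rewrite natrD (le_trans (ler_normD _ _)) // lerD //.
    by rewrite normrM -[leRHS]mulr1 ler_pM // ltW.
  by rewrite -intr_norm -natr_absz.
rewrite normrM; apply: (@le_lt_trans _ _ (n%:R * `|s|));
  first by rewrite ler_wpM2r.
by rewrite -ltr_pdivlMl ?ltr0n // mulr1 infs.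
Qed.

End Base.

Lemma sgz_addint (K : rcfType) (a : K) (c : int) :
  `|a| < 1 -> c != 0 -> sgz (a + c%:~R) = sgz c.
Proof.
rewrite ltr_norml => /andP[a1 a2].
case: (ltgtP c 0) => // [c0|c0] _.
  rewrite (ltr0_sgz c0) ltr0_sgz //.
  have : c%:~R <= (-1)%:~R :> K by rewrite ler_int; lia.
  by rewrite intrN; lra.
rewrite (gtr0_sgz c0) gtr0_sgz //.
have : 1%:~R <= c%:~R :> K by rewrite ler_int; lia.
by lra.
Qed.

Section Scales.
Variables (K L : rcfType) (s : K) (t : L).
Hypotheses (s_gt0 : 0 < s) (t_gt0 : 0 < t).
Hypotheses (inf_s : infinitesimal s) (inf_t : infinitesimal t).

Definition int_polys : set (K * L) :=
  [set u | exists p : {poly int}, u = ((map_poly intr p).[s],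
    (map_poly intr p).[t])].

(** At a positive infinitesimal the sign of an integer polynomial is that of its lowest nonzero
    coefficient, in either field. *)
Lemma int_polys_iso : partial_iso int_polys.
Proof.
split.
- by exists 1; rewrite !rmorph1 !hornerE.
- by move=> _ _ [p ->] [q ->]; exists (p - q); rewrite !rmorphB !hornerE.
- by move=> _ _ [p ->] [q ->]; exists (p * q); rewrite !rmorphM !hornerE.
- move=> _ [p ->] /=; elim/poly_ind: p => [|p c IHp].
    by rewrite !rmorph0 !horner0 !sgz0.
  rewrite !rmorphD !rmorphM /= !map_polyX !map_polyC /= !hornerMXaddC.
  have [->|c0] := eqVneq c 0.
    by rewrite !mulr0z !addr0 !sgzM IHp (gtr0_sgz s_gt0) (gtr0_sgz t_gt0).
  by rewrite !sgz_addint //; exact: infinitesimal_horner_lt1.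
Qed.

Lemma mem_int_polys : int_polys (s, t).
Proof. by exists 'X; rewrite !map_polyX !hornerX. Qed.

Lemma small_int_polys : small int_polys.
Proof.
apply: small_sub (small_image (fun p : {poly int} =>
  ((map_poly intr p).[s], (map_poly intr p).[t])) (small_countable (0 : {poly
    int}))).
by move=> _ [p ->]; exists p.
Qed.

End Scales.

Lemma total_iso (K L : rcfType) (G : set (K * L)) : partial_iso G ->
  (forall x, exists y, G (x, y)) -> (forall y, exists x, G (x, y)) ->
  field_isomorphic K L.
Proof.
move=> isoG /choice[f fG] /choice[g gG].
have [G1 GB GM _] := isoG.
have fE x y : G (x, y) -> f x = y by exact: piso_inj.
have fB : {morph f : x y / x - y} by move=> x y;
  apply/fE/(GB _ _ (fG x) (fG y)).
have fM : monoid_morphism f.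
  by split=> [|x y]; apply: fE; [exact: G1|exact: (GM _ _ (fG x) (fG y))].
pose fadd := GRing.isZmodMorphism.Build K L f fB.
pose fmul := GRing.isMonoidMorphism.Build K L f fM.
pose F : {rmorphism K -> L} := HB.pack f fadd fmul.
exists F; exists g => [x|y]; last exact: fE.
exact: (piso_inj (flip_iso isoG) (gG _) (fG x)).
Qed.

Lemma complex_isomorphic (K L : rcfType) :
  field_isomorphic K L -> field_isomorphic (complex K) (complex L).
Proof.
case=> f [g fK gK].
pose h (z : complex K) : complex L :=
  Complex (f (complex.Re z)) (f (complex.Im z)).
have hB : {morph h : x y / x - y} by case=> a b [c d]; rewrite /h /= !rmorphB.
have hM : monoid_morphism h.
  split=> [|[a b] [c d]]; rewrite /h /= ?rmorph1 ?rmorph0 //.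
  by rewrite rmorphB rmorphD !rmorphM.
pose hadd := GRing.isZmodMorphism.Build (complex K) (complex L) h hB.
pose hmul := GRing.isMonoidMorphism.Build (complex K) (complex L) h hM.
pose H : {rmorphism complex K -> complex L} := HB.pack h hadd hmul.
exists H; exists (fun z => Complex (g (complex.Re z)) (g (complex.Im z))).
  by case=> a b; rewrite /= /h /= !fK.
by case=> a b; rewrite /= /h /= !gK.
Qed.

(** * Back and forth *)

Lemma extend_both (R : realType) (K L : rcfType)
    (completeK : Cantor_complete K R) (completeL : Cantor_complete L R)
    (s : K) (t : L) (G : set (K * L)) x y :
  infinitesimal_scale s -> infinitesimal_scale t ->
  partial_iso G -> small G -> G (s, t) ->
  exists2 H : set (K * L), G `<=` H &
    [/\ partial_iso H, small H, exists b, H (x, b) & exists a, H (a, y)].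
Proof.
move=> scale_s scale_t isoG smallG Gst.
have [H GH [isoH smallH [b Hxb]]] :=
  extend_iso completeL isoG smallG Gst scale_s x.
have small_flip (M N : rcfType) (X : set (M * N)) : small X -> small (flip X).
  move=> smallX; apply: small_sub (small_image (fun u => (u.2, u.1)) smallX).
  by move=> [c d] Xdc; exists (d, c).
have [H' HH' [isoH' smallH' [a Hya]]] := extend_iso completeK (flip_iso isoH)
  (small_flip _ _ _ smallH) (GH _ Gst : flip H (t, s)) scale_t y.
exists (flip H') => [[c d] /GH Hcd|]; first exact: HH'.
split; [exact: flip_iso|exact: small_flip| |by exists a].
by exists b; exact: HH'.
Qed.

Section Transfinite.
Variables (R : realType) (K L : rcfType).
Hypotheses (completeK : Cantor_complete K R) (completeL : Cantor_complete L R).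
Variables (s : K) (t : L).
Hypotheses (scale_s : infinitesimal_scale s) (scale_t : infinitesimal_scale t).
Variable lt : K -> K -> Prop.
Hypotheses (lt_wf : well_founded lt)
  (lt_total : forall x y, [\/ lt x y, x = y | lt y x])
  (lt_small : forall x, small [set y | lt y x]).
Variable h : K -> L.
Hypothesis h_surj : forall y, exists x, h x = y.

(** Stage [x] joins all earlier stages and puts [x] into the domain and [h x] into the range; it
    stays small because segments of [lt] are, and surjectivity of [h] exhausts [L]. *)
Lemma back_and_forth : field_isomorphic K L.
Proof.
(* On unsuitable input [step] need only return a superset, so the stages are known to increase
   before they are known to be partial isomorphisms. *)
have /choice[step stepP] : forall Gx : set (K * L) * K, exists H : set (K * L),
    Gx.1 `<=` H /\ (partial_iso Gx.1 -> small Gx.1 -> Gx.1 (s, t) ->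
      [/\ partial_iso H, small H, exists b, H (Gx.2, b) & exists a, H (a,
        h Gx.2)]).
  move=> [G x] /=.
  have [[isoG smallG Gst]|bad] :=
      pselect [/\ partial_iso G, small G & G (s, t)].
    have [H GH [*]] := extend_both completeK completeL x (h x)
      scale_s scale_t isoG smallG Gst.
    by exists H.
  by exists G; split=> // isoG smallG Gst; case: bad.
pose G0 := int_polys s t.
pose below x (F : forall y, lt y x -> set (K * L)) : set (K * L) :=
  [set u | exists y (yx : lt y x), F y yx u].
pose F := Fix lt_wf (fun=> set (K * L)) (fun x rec => step (G0 `|` below x
  rec, x)).
have FE x : F x = step (G0 `|` \bigcup_(y in [set y | lt y x]) F y, x).
  rewrite /F Fix_eq => [|{}x f g fg]; last first.
    by congr (step (_ `|` below x _, x));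
      apply/functional_extensionality_dep => y;
      apply/functional_extensionality_dep.
  congr (step (_ `|` _, x)); apply/seteqP; split=> [u [y [yx Fu]]|u [y yx Fu]].
    by exists y.
  by exists y, yx.
have F_ge x : G0 `|` \bigcup_(y in [set y | lt y x]) F y `<=` F x.
  by rewrite [F x]FE; case: (stepP (G0 `|` \bigcup_(y in [set y | lt y x]) F
    y, x)).
have F0 x : G0 `<=` F x by move=> u G0u; apply: F_ge; left.
have F_mono x y : lt x y -> F x `<=` F y.
  by move=> xy u Fu; apply: F_ge; right; exists x.
have F_total x y : F x `<=` F y \/ F y `<=` F x.
  by have [/F_mono|->|/F_mono] := lt_total x y; [left|left|right].
have [s_gt0 inf_s _] := scale_s; have [t_gt0 inf_t _] := scale_t.
have isoG0 : partial_iso G0 by exact: int_polys_iso.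
have goodF x : [/\ partial_iso (F x), small (F x),
    exists b, F x (x, b) & exists a, F x (a, h x)].
  elim/(well_founded_ind lt_wf): x => x IHx; rewrite [F x]FE.
  have [_] := stepP (G0 `|` \bigcup_(y in [set y | lt y x]) F y, x);
    apply => /=.
  (* Written as the union of a chain with member [G0], which is nonempty even if [x] has no
     predecessor. *)
  - have -> : G0 `|` \bigcup_(y in [set y | lt y x]) F y =
        \bigcup_(X in [set X | X = G0 \/ exists2 y, lt y x & X = F y]) X.
      apply/seteqP; split=> [u [G0u|[y yx Fu]]|u [_ [->|[y yx ->]] Xu]].
      + by exists G0 => //; left.
      + by exists (F y) => //; right; exists y.
      + by left.
      + by right; exists y.
    apply: bigcup_iso; first by exists G0; left.
    + by move=> _ [->//|[y /IHx[isoF _ _ _] ->]].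
    + move=> _ _ [->|[y yx ->]] [->|[z zx ->]].
      * by left.
      * by left; exact: F0.
      * by right; exact: F0.
      * exact: F_total.
  - apply: small_setU => //; first exact: small_int_polys.
    by apply: small_bigcup => // y /IHx[].
  - by left; exact: mem_int_polys.
apply: (@total_iso _ _ (\bigcup_(X in range F) X)).
- apply: bigcup_iso; first by exists (F 0), 0.
  + by move=> _ [x _ <-]; case: (goodF x).
  + by move=> _ _ [x _ <-] [y _ <-].
- by move=> x; have [_ _ [b Fxb] _] := goodF x; exists b, (F x) => //; exists x.
- move=> y; have [x hx] := h_surj y; have [_ _ _ [a Fax]] := goodF x.
  by exists a, (F x); [exists x|rewrite -hx].
Qed.

End Transfinite.

Theorem theorem5p1 (R : realType)
    (two_pow_c : card_succ (set R) R)
    (K1 K2 : rcfType)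
    (hK1 : hatR_axioms R K1) (hK2 : hatR_axioms R K2) :
  field_isomorphic K1 K2 /\ field_isomorphic (complex K1) (complex K2).
Proof.
suff iso12 : field_isomorphic K1 K2 by split=> //; exact: complex_isomorphic.
case: hK1 => card1 complete1 _ [s scale_s] _.
case: hK2 => card2 complete2 _ [t scale_t] _.
have [lt [lt_wf lt_total lt_small]] := card_succ_well_order 0 card1.
(* [K1] does not inject into [R], so minimality of the cardinality of [K2] gives an injection of
   [K2] into [K1]. *)
have [g [_ ginj]] : exists g : K2 -> K1, (forall y, setT y -> setT (g y)) /\
    {in [set: K2] &, injective g}.
  apply: (card_le_inj 0); case: card2 => _ _; apply.
  by case: card1.
(* The required surjection is the inverse of [g], extended by 0 off the range of [g]. *)
apply: (@back_and_forth R K1 K2 complete1 complete2 s t scale_s scale_t lt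
  lt_wf lt_total lt_small (fun x => xget 0 [set y | g y = x])) => y.
by exists (g y); case: xgetP => [z _ /= gzy|/(_ y)[]//]; apply: ginj;
  rewrite ?inE.
Qed.
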